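(* Let $\rho_1,\rho_2$ be probability measures on $\mathbb{T}^d$. Then $$d_\infty(\rho_1,\rho_2)=\sup\Big\{r\ge0:\ \exists\, S\subseteq\mathbb{T}^d\ \text{measurable such that}\ \int_S\rho_1\,d\mathbf{x}>\int_{S_r}\rho_2\,d\mathbf{x}\Big\}.$$
   Context: $\mathbb{T}^d=(\mathbb{R}/\mathbb{Z})^d$ with its flat (quotient Euclidean) distance $\mathrm{dist}$. Measurable means Borel, and $\int_S\rho\,d\mathbf{x}$ means $\rho(S)$. For $S\subseteq\mathbb{T}^d$ and $r\ge0$, $S_r=\{\mathbf{x}\in\mathbb{T}^d:\mathrm{dist}(\mathbf{x},S)<r\}$ (so $S_r=\bigcup_{\mathbf{x}\in S}B(\mathbf{x};r)$ with open balls for $r>0$, $S_0=\emptyset$, and $\emptyset_r=\emptyset$). $d_\infty(\rho_1,\rho_2)=\inf_{\mu\in\Pi(\rho_1,\rho_2)}\sup_{(\mathbf{x},\mathbf{y})\in\mathrm{supp}\,\mu}\mathrm{dist}(\mathbf{x},\mathbf{y})$, where $\Pi(\rho_1,\rho_2)$ is the set of probability measures on $\mathbb{T}^d\times\mathbb{T}^d$ with first marginal $\rho_1$ and second marginal $\rho_2$. *)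

(* Defs.v *)
From HB Require Import structures.
From mathcomp Require Import all_boot all_order all_algebra.
From mathcomp Require Import ring lra.
From mathcomp Require Import all_classical all_reals all_analysis.
Set Implicit Arguments.
Unset Strict Implicit.
Unset Printing Implicit Defensive.
Import Order.TTheory GRing.Theory Num.Theory.
Import numFieldNormedType.Exports.
Local Open Scope classical_set_scope.
Local Open Scope ring_scope.
Local Open Scope quotient_scope.

Definition enorm (R : rcfType) (d : nat) (v : 'rV[R]_d) : R :=
  Num.sqrt (\sum_(i < d) v ord0 i ^+ 2).

Section enorm_theory.
Context {R : rcfType} {d : nat}.
Implicit Types u v : 'rV[R]_d.

Lemma enorm_ge0 u : 0 <= enorm u.
Proof. exact: sqrtr_ge0. Qed.

Lemma sqr_enorm u : enorm u ^+ 2 = \sum_(i < d) u ord0 i ^+ 2.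
Proof. by rewrite sqr_sqrtr// sumr_ge0// => i _; exact: sqr_ge0. Qed.

Lemma enorm0 : enorm (0 : 'rV[R]_d) = 0.
Proof.
by rewrite /enorm big1 ?sqrtr0// => i _; rewrite mxE expr0n.
Qed.

Lemma enormN u : enorm (- u) = enorm u.
Proof. by congr Num.sqrt; apply: eq_bigr => i _; rewrite mxE sqrrN. Qed.

Lemma ler_coord_enorm u i : `|u ord0 i| <= enorm u.
Proof.
rewrite -sqrtr_sqr ler_wsqrtr// (bigD1 i)//= lerDl sumr_ge0// => j _.
exact: sqr_ge0.
Qed.

Lemma cauchy_schwarz_enorm u v :
  \sum_(i < d) u ord0 i * v ord0 i <= enorm u * enorm v.
Proof.
set a := enorm u; set b := enorm v.
have [a0|a0] := eqVneq a 0.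
  rewrite a0 mul0r big1// => i _.
  have := ler_coord_enorm u i; rewrite -/a a0 normr_le0 => /eqP ->.
  by rewrite mul0r.
have [b0|b0] := eqVneq b 0.
  rewrite b0 mulr0 big1// => i _.
  have := ler_coord_enorm v i; rewrite -/b b0 normr_le0 => /eqP ->.
  by rewrite mulr0.
have ap : 0 < a by rewrite lt0r a0 enorm_ge0.
have bp : 0 < b by rewrite lt0r b0 enorm_ge0.
have -> : a * b =
    \sum_(i < d) (b / a * u ord0 i ^+ 2 + a / b * v ord0 i ^+ 2) / 2.
  rewrite -mulr_suml big_split/= -!mulr_sumr -!sqr_enorm -/a -/b.
  by field; rewrite a0 b0.
apply: ler_sum => i _; rewrite -subr_ge0.
set x := u _ _; set y := v _ _.
have -> : (b / a * x ^+ 2 + a / b * y ^+ 2) / 2 - x * y =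
    (b * x - a * y) ^+ 2 / (2 * a * b) by field; rewrite a0 b0.
by rewrite divr_ge0 ?sqr_ge0// !mulr_ge0 ?ltW.
Qed.

Lemma ler_enormD u v : enorm (u + v) <= enorm u + enorm v.
Proof.
rewrite -(@ler_pXn2r _ 2)// ?nnegrE ?addr_ge0 ?enorm_ge0// sqr_enorm.
have -> : \sum_(i < d) (u + v) ord0 i ^+ 2 =
    enorm u ^+ 2 + enorm v ^+ 2 + 2 * \sum_(i < d) u ord0 i * v ord0 i.
  rewrite !sqr_enorm mulr_sumr -!big_split/=; apply: eq_bigr => i _.
  by rewrite mxE; ring.
have := cauchy_schwarz_enorm u v; set s := \sum_(_ < _) _.
lra.
Qed.

End enorm_theory.

Section torus_def.
Context {R : realType} (d : nat).

Definition lattice_rel (x y : 'rV[R]_d) : bool :=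
  [forall i, (x - y) ord0 i \is a Num.int].

Lemma lattice_rel_refl : reflexive lattice_rel.
Proof. by move=> x; apply/forallP => i; rewrite subrr mxE rpred0. Qed.

Lemma lattice_rel_sym : symmetric lattice_rel.
Proof.
by move=> x y; apply: eq_forallb => i; rewrite -opprB mxE rpredN.
Qed.

Lemma lattice_rel_trans : transitive lattice_rel.
Proof.
move=> y x z /forallP xy /forallP yz; apply/forallP => i.
by rewrite -(subrKA y) mxE rpredD.
Qed.

Canonical lattice_equiv :=
  EquivRel lattice_rel lattice_rel_refl lattice_rel_sym lattice_rel_trans.

End torus_def.

(* (R/Z)^d, presented as the quotient of R^d by the lattice Z^d *)
Definition torus (R : realType) (d : nat) : Type :=
  {eq_quot @lattice_equiv R d}.

HB.instance Definition _ (R : realType) (d : nat) :=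
  EqQuotient.copy (torus R d) {eq_quot @lattice_equiv R d}.
HB.instance Definition _ (R : realType) (d : nat) :=
  Choice.copy (torus R d) {eq_quot @lattice_equiv R d}.

Definition torus_dist (R : realType) (d : nat) (p q : torus R d) : R :=
  inf [set enorm (x.1 - x.2) | x in
    [set x : 'rV[R]_d * 'rV[R]_d | \pi x.1 = p /\ \pi x.2 = q]].

Section torus_metric.
Context {R : realType} {d : nat}.
Local Notation T := (torus R d).
Implicit Types (p q r : T) (x y : 'rV[R]_d).

Lemma torus_piP x y :
  \pi_T x = \pi_T y <-> forall i, (x - y) ord0 i \is a Num.int.
Proof.
split=> [/eqmodP/forallP //|xy].
by apply/eqmodP/forallP.
Qed.

Let reps p q : set R := [set enorm (x.1 - x.2) | x in
  [set x : 'rV[R]_d * 'rV[R]_d | \pi_T x.1 = p /\ \pi_T x.2 = q]].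

Let reps_neq0 p q : reps p q !=set0.
Proof.
by exists (enorm (repr p - repr q)), (repr p, repr q) => //=; rewrite !reprK.
Qed.

Let reps_lb p q : lbound (reps p q) 0.
Proof. by move=> _ [x _ <-]; exact: enorm_ge0. Qed.

Lemma torus_dist_le x y : torus_dist (\pi_T x) (\pi_T y) <= enorm (x - y).
Proof.
apply: ge_inf; first by exists 0; exact: reps_lb.
by exists (x, y).
Qed.

Lemma torus_dist_lt p q (e : R) : torus_dist p q < e ->
  exists x y, [/\ \pi_T x = p, \pi_T y = q & enorm (x - y) < e].
Proof.
move=> /inf_lt => /(_ (reps_neq0 p q))[_ [[x y] /= [xp yq] <-] xye].
by exists x, y.
Qed.

Lemma torus_dist_ge0 p q : 0 <= torus_dist p q.
Proof. by apply: lb_le_inf; [exact: reps_neq0|exact: reps_lb]. Qed.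

Lemma torus_distxx p : torus_dist p p = 0.
Proof.
apply/eqP; rewrite eq_le torus_dist_ge0 andbT -[p]reprK.
by rewrite (le_trans (torus_dist_le _ _))// subrr enorm0.
Qed.

Let torus_dist_sym_le p q : torus_dist p q <= torus_dist q p.
Proof.
apply/ler_addgt0Pl => e e0.
have /torus_dist_lt[x [y [<- <- xy]]] : torus_dist q p < e + torus_dist q p.
  by rewrite ltrDr.
by rewrite (le_trans (torus_dist_le _ _))// -opprB enormN ltW.
Qed.

Lemma torus_dist_sym p q : torus_dist p q = torus_dist q p.
Proof. by apply/eqP; rewrite eq_le !torus_dist_sym_le. Qed.

Lemma torus_dist_triangle q p r :
  torus_dist p r <= torus_dist p q + torus_dist q r.
Proof.
apply/ler_addgt0Pl => e e0.
have e20 : 0 < e / 2 by rewrite divr_gt0.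
have /torus_dist_lt[x [y [xp yq xy]]] :
  torus_dist p q < e / 2 + torus_dist p q by rewrite ltrDr.
have /torus_dist_lt[y' [z [y'q zr y'z]]] :
  torus_dist q r < e / 2 + torus_dist q r by rewrite ltrDr.
have z'r : \pi_T (z + (y - y')) = r.
  rewrite -zr; apply/torus_piP => i.
  have -> : z + (y - y') - z = y - y' by rewrite addrC addKr.
  by apply/torus_piP : i; rewrite yq y'q.
rewrite -xp -z'r (le_trans (torus_dist_le _ _))//.
have -> : x - (z + (y - y')) = (x - y) + (y' - z).
  by apply/matrixP => i j; rewrite !mxE; ring.
rewrite (le_trans (ler_enormD _ _))// xp z'r.
by lra.
Qed.

Lemma torus_dist_positivity p q : torus_dist p q = 0 -> p = q.
Proof.
move=> pq0; rewrite -[p]reprK -[q]reprK; apply/torus_piP => i.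
set t := (repr p - repr q) ord0 i.
have near_int (e : R) : 0 < e -> exists2 k, k \is a Num.int & `|t - k| < e.
  rewrite -pq0 => /torus_dist_lt[x [y [xp yq xye]]].
  exists (t - (x - y) ord0 i); last first.
    by rewrite opprB addrCA subrr addr0 (le_lt_trans (ler_coord_enorm _ _)).
  have -> : t - (x - y) ord0 i =
      (repr p - x) ord0 i - (repr q - y) ord0 i.
    by rewrite /t !mxE; ring.
  have intB z z' : \pi_T z = \pi_T z' -> (z - z') ord0 i \is a Num.int.
    by move/torus_piP.
  by apply: rpredB; apply: intB; rewrite reprK.
have [//|tN] := boolP (t \is a Num.int).
have fl : (Num.floor t)%:~R < t.
  rewrite lt_neqAle Num.Theory.floor_le andbT.
  by rewrite -intrEfloor.
have fu : t < (Num.floor t + 1)%:~R by exact: Num.Theory.floorD1_gt.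
have [|k] := near_int (Num.min (t - (Num.floor t)%:~R)
                         ((Num.floor t + 1)%:~R - t)).
  by rewrite lt_min !subr_gt0 fl.
move=> /intrP[m ->]; rewrite lt_min !ltr_norml.
move=> /andP[/andP[_ a] /andP[b _]].
have : (Num.floor t)%:~R < m%:~R :> R by lra.
have : m%:~R < (Num.floor t + 1)%:~R :> R by lra.
by rewrite !ltr_int ltzD1 => /le_lt_trans/[apply]; rewrite ltxx.
Qed.

End torus_metric.

HB.instance Definition _ (R : realType) (d : nat) :=
  isMetric.Build R (torus R d) (@torus_distxx R d) (@torus_dist_positivity R d)
    (@torus_dist_sym R d) (@torus_dist_triangle R d).

HB.instance Definition _ (R : realType) (d : nat) :=
  isPointed.Build (torus R d) (\pi_(torus R d) 0).

HB.instance Definition _ (R : realType) (d : nat) :=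
  Measurable.copy (torus R d) (g_sigma_algebraType (@open (torus R d))).

(* dist(x, S), with value +oo when S is empty *)
Definition dist_to_set (R : realType) (d : nat) (S : set (torus R d))
    (x : torus R d) : \bar R :=
  ereal_inf [set (mdist x y)%:E | y in S].

Definition thickening (R : realType) (d : nat) (S : set (torus R d)) (r : R)
  : set (torus R d) :=
  [set x | (dist_to_set S x < r%:E)%E].

Definition measure_support (R : realType) (d : nat)
    (mu : probability (torus R d * torus R d)%type R)
  : set (torus R d * torus R d) :=
  [set z | forall U, open U -> U z -> (0 < mu U)%E].

Definition couplings (R : realType) (d : nat)
    (rho1 rho2 : probability (torus R d) R)
  : set (probability (torus R d * torus R d)%type R) :=
  [set mu | forall A, measurable A ->
     pushforward mu fst A = rho1 A /\ pushforward mu snd A = rho2 A].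

Definition d_infty (R : realType) (d : nat)
    (rho1 rho2 : probability (torus R d) R) : \bar R :=
  ereal_inf [set ereal_sup [set (mdist z.1 z.2)%:E | z in measure_support mu]
            | mu in couplings rho1 rho2].

(* Main.v *)
From HB Require Import structures.
Require Import Defs.
From mathcomp Require Import all_boot all_order all_algebra.
From mathcomp Require Import ring lra.
From mathcomp Require Import all_classical all_reals all_analysis.
Import Order.TTheory GRing.Theory Num.Theory.

(** The theorem is a duality: the best worst-case transport distance equals the
    supremum of the radii r at which some set S is a witness, that is, has more
    mass under rho1 than its r-neighbourhood has under rho2.

    A witness (S, r) bounds every coupling from below
    ([mass_gap_le_support_diameter]): a coupling carried by pairs at distance
    less than r maps the mass of S into the r-neighbourhood of S. The point to
    check is that a coupling is carried by its support, which follows from a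
    countable base of the square of the torus ([torus_square_base],
    [support_setC_negligible]).

    Conversely, let r exceed the supremum, so that no set is a witness at r.
    Partition the torus into finitely many Borel cells of diameter less than
    e / 2 ([torus_small_cells]) and join two cells when they contain points at
    distance less than r. The absence of witnesses among unions of cells is
    exactly the condition of Hall's theorem with weights ([weighted_hall]),
    which yields a finite transport plan between joined cells. Spreading the
    plan over products of cells ([glue_coupling]) gives a coupling supported
    on pairs at distance at most r + e ([exists_coupling_near]). As r and e vary,
    these couplings bring the infimum down to the supremum. *)

(** * Hall's theorem with weights *)

Section weighted_hall.
Import mathcomp.boot.fintype mathcomp.boot.finset.
Local Open Scope ring_scope.

Definition neighbours {I J : finType} (E : {set I * J}) (B : {set I}) :
    {set J} :=
  [set j | [exists i in B, (i, j) \in E]].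

Lemma neighboursS {I J : finType} (E E' : {set I * J}) (B B' : {set I}) :
  E \subset E' -> B \subset B' -> neighbours E B \subset neighbours E' B'.
Proof.
move=> EE' BB'; apply/subsetP => j; rewrite !inE => /exists_inP[i iB ij].
by apply/exists_inP; exists i; [exact: (subsetP BB')|exact: (subsetP EE')].
Qed.

Lemma sumr_setS {R : realFieldType} {J : finType} {b : J -> R}
    (C C' : {set J}) :
  (forall j, 0 <= b j) -> C \subset C' ->
  \sum_(j in C) b j <= \sum_(j in C') b j.
Proof.
move=> b0 /subsetP CC'; rewrite [leRHS](bigID (mem C))/=.
rewrite [X in _ <= X + _](eq_bigl (mem C)).
  by rewrite lerDl sumr_ge0.
by move=> j /=; rewrite andb_idl//; exact: CC'.
Qed.

Lemma sumr_setUI {R : realFieldType} {J : finType} (b : J -> R)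
    (C C' : {set J}) :
  \sum_(j in C) b j + \sum_(j in C') b j =
  \sum_(j in C :|: C') b j + \sum_(j in C :&: C') b j.
Proof.
rewrite [X in X + _ = _](big_setID C')/= [X in _ = X + _](big_setID C')/=.
rewrite (setIidPr (subsetUr C C')) setDUl setDv setU0.
by rewrite -addrA addrC [X in X + _ = _]addrC.
Qed.

Lemma sumr_set_subr_at {R : realFieldType} {I : finType} (a : I -> R)
    (i : I) (t : R) (B : {set I}) :
  \sum_(k in B) (a k - (if k == i then t else 0)) =
  \sum_(k in B) a k - (if i \in B then t else 0).
Proof.
rewrite sumrB; congr (_ - _); rewrite -big_mkcondr/=.
case: ifPn => iB.
  by rewrite (big_pred1 i)// => k /=; case: eqVneq => [->|]; rewrite ?iB ?andbF.
by rewrite big_pred0// => k; case: eqVneq => [->|]; rewrite ?(negPf iB) ?andbF.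
Qed.

(** By induction on the number of edges. Fix an edge (i, j) and ship an amount
    t along it, so that the remaining problem satisfies the same condition
    without that edge. Sets B that contain i and lose the neighbour j force
    t to be at least their deficiency g B; the masses of i and j, and the
    slack of sets that avoid i but see j, bound t from above. Each of these
    lower bounds is below each of the upper bounds, because set sums are
    modular while the neighbours of an intersection lie in the intersection of
    the neighbours (uncrossing); hence the least candidate for t, the largest
    deficiency or 0, works. *)
Lemma weighted_hall (R : realFieldType) (I J : finType) (E : {set I * J})
    (a : I -> R) (b : J -> R) :
  (forall i, 0 <= a i) -> (forall j, 0 <= b j) ->
  \sum_i a i = \sum_j b j ->
  (forall B : {set I},
    \sum_(i in B) a i <= \sum_(j in neighbours E B) b j) ->
  exists w : I -> J -> R,
    [/\ forall i j, 0 <= w i j,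
        forall i j, (i, j) \notin E -> w i j = 0,
        forall i, \sum_j w i j = a i &
        forall j, \sum_i w i j = b j].
Proof.
have [m] := ubnP #|E|; elim: m E a b => // m IH E a b /ltnSE Em a0 b0 ab hall.
have [E0|[[i j] ijE]] := set_0Vmem E.
  have a_0 i : a i = 0.
    apply/eqP; rewrite eq_le a0 andbT.
    have := hall [set i]; rewrite big_set1 big_pred0// => j.
    by rewrite inE E0; apply/exists_inP => -[k _]; rewrite inE.
  have b_0 j : b j = 0.
    have /eqP := ab; rewrite big1// eq_sym psumr_eq0// => /allP/(_ j).
    by rewrite mem_index_enum => /(_ isT)/eqP.
  by exists (fun _ _ => 0); split=> // [k|k]; rewrite big1// ?a_0 ?b_0.
set E' := E :\ (i, j).
have E'E : E' \subset E by exact: subD1set.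
pose g (B : {set I}) :=
  \sum_(k in B) a k - \sum_(l in neighbours E' B) b l.
pose P (B : {set I}) := (i \in B) && (j \notin neighbours E' B).
pose t := \big[Num.max/0]_(B | P B) g B.
have nbrE (B : {set I}) : i \notin B -> neighbours E B = neighbours E' B.
  move=> iB; apply/setP => l; rewrite !inE; apply: eq_existsb => k.
  rewrite !inE xpair_eqE; case: eqVneq => [->|//].
  by rewrite (negPf iB).
have nbrE' (B : {set I}) : neighbours E B \subset j |: neighbours E' B.
  apply/subsetP => l; rewrite !inE => /exists_inP[k kB kl].
  case: eqVneq => //= lj; apply/exists_inP; exists k => //.
  by rewrite !inE kl xpair_eqE (negPf lj) andbF.
have t0 : 0 <= t by apply: bigmax_ge_id.
have t_le (x : R) : 0 <= x -> (forall B, P B -> g B <= x) -> t <= x.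
  by move=> x0 H; apply/bigmax_leP.
have gt B : P B -> g B <= t by move=> PB; exact: le_bigmax_cond.
have ta : t <= a i.
  apply: t_le => // B /andP[iB _]; rewrite /g (big_setD1 i iB)/=.
  have := hall (B :\ i); rewrite nbrE ?setD11//.
  have := sumr_setS _ _ b0 (neighboursS _ _ _ _ (subxx E') (subD1set B i)).
  lra.
have tb : t <= b j.
  apply: t_le => // B /andP[iB jB]; rewrite /g.
  have := sumr_setS _ _ b0 (nbrE' B); rewrite big_setU1//=.
  have := hall B; lra.
(* uncrossing: the condition for B :|: C and B :&: C bounds g C by the slack
   of B *)
have tN (B : {set I}) : i \notin B -> j \in neighbours E' B ->
    t <= \sum_(l in neighbours E' B) b l - \sum_(k in B) a k.
  move=> iB jB; apply: t_le => [|C /andP[iC jC]].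
    by rewrite subr_ge0 -nbrE.
  rewrite /g.
  have := sumr_setUI a B C.
  have := sumr_setUI b (neighbours E' B) (neighbours E' C).
  have := hall (B :|: C).
  have := hall (B :&: C); rewrite nbrE; last by rewrite inE (negPf iB).
  have : neighbours E' (B :&: C) \subset neighbours E' B :&: neighbours E' C.
    by rewrite subsetI !neighboursS ?subsetIl ?subsetIr.
  move=> /(sumr_setS _ _ b0).
  have : neighbours E (B :|: C) \subset neighbours E' B :|: neighbours E' C.
    apply/(subset_trans (nbrE' _))/subsetP => l.
    rewrite in_setU1 in_setU => /orP[/eqP ->|]; first by rewrite jB.
    rewrite !inE => /exists_inP[k]; rewrite inE => /orP[kB|kC] kl.
      by apply/orP; left; apply/exists_inP; exists k.
    by apply/orP; right; apply/exists_inP; exists k.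
  move=> /(sumr_setS _ _ b0).
  lra.
pose a' k := a k - (if k == i then t else 0).
pose b' l := b l - (if l == j then t else 0).
have [|||||w [w0 wE wa wb]] := IH E' a' b'.
- by rewrite (leq_trans _ Em)// [ltnRHS](cardsD1 (i, j)) ijE.
- by move=> k; rewrite /a'; case: eqVneq => [->|]; rewrite ?subr0// subr_ge0.
- by move=> l; rewrite /b'; case: eqVneq => [->|]; rewrite ?subr0// subr_ge0.
- have := sumr_set_subr_at a i t setT; have := sumr_set_subr_at b j t setT.
  under eq_bigl do rewrite inE.
  under [in X in _ = X - _ -> _]eq_bigl do rewrite inE.
  move=> Hb.
  under eq_bigl do rewrite inE.
  under [in X in _ = X - _ -> _]eq_bigl do rewrite inE.
  by rewrite /a' /b' => ->; rewrite Hb ab !inE.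
- move=> B; rewrite /a' /b' !sumr_set_subr_at.
  have HB := hall B.
  have [iB|iB] := boolP (i \in B); have [jB|jB] := boolP (j \in _).
  + have : neighbours E B \subset neighbours E' B.
      by rewrite (subset_trans (nbrE' B))// subUset sub1set jB subxx.
    by move=> /(sumr_setS _ _ b0); lra.
  + by have := gt B; rewrite /P iB jB => /(_ isT); rewrite /g; lra.
  + by have := tN B iB jB; lra.
  + by rewrite -nbrE// !subr0.
have jiE' : (i, j) \notin E' by rewrite setD11.
(* put back the amount t along the deleted edge *)
exists (fun k l => w k l + (if (k == i) && (l == j) then t else 0)); split.
- by move=> k l; rewrite addr_ge0//; case: ifP.
- move=> k l kl; rewrite wE; last by apply: contra kl => /(subsetP E'E).
  rewrite add0r; case: andP => // -[/eqP ki /eqP lj].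
  by move: kl; rewrite ki lj ijE.
- move=> k; rewrite big_split/= wa /a'; case: eqVneq => [ki|ki]/=.
    by rewrite -big_mkcond/= big_pred1_eq subrK.
  by rewrite big1// subr0 addr0.
- move=> l; rewrite big_split/= wb /b'; case: eqVneq => [lj|lj]/=.
    under eq_bigr do rewrite andbT.
    by rewrite -big_mkcond/= big_pred1_eq subrK.
  by rewrite big1 ?subr0 ?addr0// => k _; rewrite andbF.
Qed.

End weighted_hall.

Local Open Scope classical_set_scope.
Local Open Scope ring_scope.

(** * Finite nets, small cells and open sets on the torus *)

Section torus_geometry.
Local Open Scope quotient_scope.

Lemma enorm_le_sum {R : rcfType} {d : nat} (v : 'rV[R]_d) :
  enorm v <= \sum_(i < d) `|v ord0 i|.
Proof.
have s0 : 0 <= \sum_(i < d) `|v ord0 i| by apply: sumr_ge0.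
rewrite -(@ler_pXn2r _ 2)// ?nnegrE ?enorm_ge0// sqr_enorm.
rewrite [leRHS]expr2 mulr_suml; apply: ler_sum => i _.
by rewrite -real_normK ?num_real// expr2 ler_wpM2l//
  (bigD1 i)//= lerDl sumr_ge0.
Qed.

(** The net is the grid of points whose coordinates are multiples of 1/N:
    reducing each coordinate to [0, 1) and rounding it down to such a multiple
    moves a point by at most d / N. *)
Lemma torus_finite_net {R : realType} {d : nat} (e : R) : 0 < e ->
  exists n (c : nat -> torus R d),
    forall x, exists2 i, (i < n)%N & mdist (c i) x < e.
Proof.
move=> e0.
pose N := (Num.truncn (d%:R / e)).+1.
have N0 : 0 < N%:R :> R by rewrite ltr0n.
have dN : d%:R / N%:R < e.
  by rewrite ltr_pdivrMr// mulrC -ltr_pdivrMr// truncnS_gt.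
pose c (f : {ffun 'I_d -> 'I_N}) : torus R d :=
  \pi_(torus R d) (\row_(j < d) ((f j)%:R / N%:R)).
pose f0 : {ffun 'I_d -> 'I_N} := [ffun=> ord0].
exists #|{ffun 'I_d -> 'I_N}|.
exists (fun k => c (nth f0 (enum {ffun 'I_d -> 'I_N}) k)) => x.
pose v : 'rV[R]_d := \row_j (repr x ord0 j - (Num.floor (repr x ord0 j))%:~R).
have vx : \pi_(torus R d) v = x.
  rewrite -[RHS]reprK; apply/torus_piP => j.
  by rewrite !mxE addrAC subrr add0r rpredN intr_int.
have v0 j : 0 <= v ord0 j by rewrite mxE subr_ge0 Num.Theory.floor_le.
have v1 j : v ord0 j < 1.
  by rewrite mxE ltrBlDr -[1]/(1%:~R) -intrD addrC Num.Theory.floorD1_gt.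
have tN j : (Num.truncn (v ord0 j * N%:R) < N)%N.
  by rewrite truncn_lt_nat ?mulr_ge0// gtr_pMl.
pose f : {ffun 'I_d -> 'I_N} := [ffun j => Ordinal (tN j)].
exists (index f (enum {ffun 'I_d -> 'I_N})).
  by rewrite cardE index_mem mem_enum.
rewrite nth_index ?mem_enum// -vx.
apply: (le_lt_trans (torus_dist_le _ _)); apply: (le_lt_trans (enorm_le_sum _)).
apply: (le_lt_trans _ dN).
rewrite -[in leRHS](card_ord d) mulr_natl -sumr_const.
apply: ler_sum => j _; rewrite !mxE ffunE/=.
set t := Num.truncn _.
have /truncn_itv/andP[t1 t2] : 0 <= v ord0 j * N%:R by rewrite mulr_ge0.
rewrite distrC -[X in `|X - _|](mulfK (lt0r_neq0 N0)) -mulrBl normrM.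
rewrite [`|N%:R^-1|]gtr0_norm ?invr_gt0// -[leRHS]mul1r ler_pM2r ?invr_gt0//.
move: t1 t2; rewrite -/t mxE -natr1 => t1 t2.
by rewrite ger0_norm; lra.
Qed.

Lemma torus_open_measurable {R : realType} {d : nat} (U : set (torus R d)) :
  open U -> measurable U.
Proof. by move=> oU; apply: sub_sigma_algebra. Qed.

Lemma metric_ball_open {R : realType} {T : metricType R} (x : T) (e : R) :
  open [set y | mdist x y < e].
Proof.
rewrite openE => y /= xy; apply/nbhs_ballP; exists (e - mdist x y) => /=.
  by rewrite subr_gt0.
move=> z; rewrite ballEmdist/= ltrBrDl; apply: le_lt_trans.
exact: metric_triangle.
Qed.

(** Cells of small diameter turn the transport problem into a finite one;
    they are obtained by making the balls of a finite net disjoint. *)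
Lemma torus_small_cells {R : realType} {d : nat} (e : R) : 0 < e ->
  exists n (A : 'I_n -> set (torus R d)),
    [/\ forall i, measurable (A i), trivIset setT A,
        \bigcup_i A i = setT &
        forall i x y, A i x -> A i y -> mdist x y < e].
Proof.
move=> e0; have e20 : 0 < e / 2 by rewrite divr_gt0.
have [n [c net]] := @torus_finite_net R d _ e20.
pose F k := [set y | mdist (c k) y < e / 2].
exists n, (fun i => seqDU F i); split.
- move=> i; apply: seqDU_measurable => k; apply: torus_open_measurable.
  exact: metric_ball_open.
- move=> i j _ _ ij; exact/val_inj/(@trivIset_seqDU _ F _ _ I I ij).
- apply/seteqP; split=> // x _; have [i ltin ix] := net x.
  (* x belongs to the cell of the first ball that contains it *)
  have [k [Fk kmin]] : exists k, F k x /\ forall m, F m x -> (k <= m)%N.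
    have exP : exists k, `[< F k x >] by exists i; apply/asboolP.
    exists (ex_minn exP); case: ex_minnP => k /asboolP Fk kmin; split=> // m Fm.
    by apply: kmin; apply/asboolP.
  exists (Ordinal (leq_ltn_trans (kmin _ ix) ltin)) => //=.
  split=> //; rewrite -bigcup_mkord => -[m /= mk Fm].
  by have := kmin _ Fm; rewrite leqNgt mk.
- move=> i x y Ax Ay; have ix := subset_seqDU Ax; have iy := subset_seqDU Ay.
  rewrite (splitr e) (le_lt_trans (metric_triangle _ (c i) _))//.
  by rewrite metric_sym ltrD.
Qed.

Lemma thickening_bigcup {R : realType} {d : nat} (S : set (torus R d)) (r : R) :
  thickening S r = \bigcup_(y in S) [set x | mdist y x < r].
Proof.
apply/seteqP; split=> x.
  by move=> /ereal_inf_lt[_ [y Sy <-]]; rewrite lte_fin metric_sym; exists y.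
move=> [y Sy]; rewrite /= metric_sym => xy.
apply: (@le_lt_trans _ _ (mdist x y)%:E).
  by apply: ereal_inf_lbound; exists y.
by rewrite lte_fin.
Qed.

Lemma thickening_measurable {R : realType} {d : nat}
    (S : set (torus R d)) (r : R) :
  measurable (thickening S r).
Proof.
apply: torus_open_measurable; rewrite thickening_bigcup; apply: bigcup_open.
by move=> y _; exact: metric_ball_open.
Qed.

(** The measure on the square lives on the product of the Borel sigma-algebras,
    whereas supports are defined with open sets of the product topology; a
    countable base made of products of balls reconciles the two. *)
Lemma torus_square_base {R : realType} {d : nat} :
  exists B : nat -> set (torus R d * torus R d),
    (forall n, measurable (B n)) /\
    forall U z, open U -> U z -> exists n, B n z /\ B n `<=` U.
Proof.
have pos k : 0 < k.+1%:R^-1 :> R by rewrite invr_gt0 ltr0n.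
have /choice[c cP] : forall k : nat, exists c : nat -> torus R d,
    forall x, exists i, mdist (c i) x < k.+1%:R^-1.
  move=> k; have [n [c net]] := @torus_finite_net R d _ (pos k).
  by exists c => x; have [i _ ix] := net x; exists i.
pose b k i := [set y : torus R d | mdist (c k i) y < k.+1%:R^-1].
pose B (p : nat * nat * nat) := b p.1.1 p.1.2 `*` b p.1.1 p.2.
exists (fun n => odflt set0 (omap B (unpickle n))); split.
  move=> n; case: unpickle => [p|]/=; last exact: measurable0.
  by apply: measurableX; apply: torus_open_measurable; exact: metric_ball_open.
move=> U [x y]; rewrite openE => /[apply]; rewrite /interior => -[[V W]/=[]].
move=> /nbhs_ballP[e1/= e10 eV] /nbhs_ballP[e2/= e20 eW] VWU.
pose e := Num.min e1 e2.
have e0 : 0 < e by rewrite lt_min e10 e20.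
pose k := Num.truncn (2 / e).
have ke : k.+1%:R^-1 + k.+1%:R^-1 < e.
  rewrite -mulr2n -[_ *+ 2]mulr_natl ltr_pdivrMr ?ltr0n// mulrC.
  by rewrite -ltr_pdivrMr// truncnS_gt.
have [i ix] := cP k x; have [j jy] := cP k y.
exists (pickle (k, i, j)); rewrite pickleK /=; split=> //.
move=> [x' y'] [/= ix' jy']; apply: VWU; split=> /=.
  apply: eV; rewrite ballEmdist/=.
  have : mdist x x' < e.
    rewrite (le_lt_trans (metric_triangle _ (c k i) _))// (lt_trans _ ke)//.
    by rewrite metric_sym ltrD.
  by rewrite lt_min => /andP[].
apply: eW; rewrite ballEmdist/=.
have : mdist y y' < e.
  rewrite (le_lt_trans (metric_triangle _ (c k j) _))// (lt_trans _ ke)//.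
  by rewrite metric_sym ltrD.
by rewrite lt_min => /andP[].
Qed.

Lemma torus_square_open_measurable {R : realType} {d : nat}
    (U : set (torus R d * torus R d)) : open U -> measurable U.
Proof.
move=> oU; have [B [mB baseB]] := @torus_square_base R d.
have -> : U = \bigcup_(n in [set n | B n `<=` U]) B n.
  apply/seteqP; split=> [z Uz|z [n /= BU /BU//]].
  by have [n [Bz BU]] := baseB _ _ oU Uz; exists n.
exact: bigcup_measurable.
Qed.

Lemma support_setC_negligible {R : realType} {d : nat}
    (mu : probability (torus R d * torus R d)%type R) :
  mu.-negligible (~` measure_support mu).
Proof.
have [B [mB baseB]] := @torus_square_base R d.
(* a point outside the support has a null open neighbourhood, hence lies in a
   null box of the base, and there are countably many of these *)
pose N n := if mu (B n) == 0%E then B n else set0.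
apply: (@negligibleS _ _ _ mu (\bigcup_n N n)); last first.
  apply: negligible_bigcup => n; rewrite /N; case: ifPn => [/eqP B0|_].
    exact/negligibleP.
  exact: negligible_set0.
move=> z /existsNP[U /not_implyP[oU /not_implyP[Uz /negP]]].
rewrite lt_neqAle measure_ge0 andbT negbK eq_sym => /eqP U0.
have [n [Bz BU]] := baseB _ _ oU Uz; exists n => //.
rewrite /N ifT// eq_le measure_ge0 andbT -U0 le_measure ?inE//.
exact: torus_square_open_measurable.
Qed.

End torus_geometry.

(** * Gluing a coupling from a finite transport plan *)

Lemma measure_finite_union {dT : measure_display} {T : measurableType dT}
    {R : realType} (mu : {measure set T -> \bar R}) {I : finType}
    (A : I -> set T) (B : {set I}) :
  (forall i, measurable (A i)) -> trivIset setT A ->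
  mu (\bigcup_(i in [set` B]) A i) = (\sum_(i in B) mu (A i))%E.
Proof.
move=> mA tA; rewrite measure_fin_bigcup//; last exact: sub_trivIset tA.
rewrite -big_enum [RHS]fsbig_seq ?enum_uniq//.
by apply: eq_fsbigl; apply/seteqP; split=> i /=; rewrite mem_enum.
Qed.

Lemma measure_partition {dT : measure_display} {T : measurableType dT}
    {R : realType} (mu : {measure set T -> \bar R}) {I : finType}
    (A : I -> set T) (S : set T) :
  (forall i, measurable (A i)) -> trivIset setT A -> \bigcup_i A i = setT ->
  measurable S -> mu S = (\sum_i mu (S `&` A i))%E.
Proof.
move=> mA tA cA mS; rewrite -[in LHS](setIT S) -cA setI_bigcupr.
rewrite measure_fin_bigcup//.
- rewrite [RHS]fsbig_seq ?index_enum_uniq//.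
  by apply: eq_fsbigl; apply/seteqP; split=> i //= _; rewrite mem_index_enum.
- exact: finite_finset.
- by move=> i j _ _ [x [[_ ix] [_ jx]]]; apply: tA => //; exists x.
- by move=> i _; exact: measurableI.
Qed.

Lemma measure_finite_sum {dT : measure_display} {T : measurableType dT}
    {R : realType} {I : finType} (m : I -> {measure set T -> \bar R}) :
  exists mu : {measure set T -> \bar R}, forall Z, mu Z = (\sum_i m i Z)%E.
Proof.
pose s := [seq m i | i <- index_enum I].
exists (msum (nth (mzero : measure T R) s) (size s)) => Z.
transitivity (\sum_(k < size s) nth (mzero : measure T R) s k Z)%E => //.
rewrite -(big_mkord xpredT (fun k => nth (mzero : measure T R) s k Z)).
by rewrite -(big_nth _ xpredT (fun x : measure T R => x Z)) big_map.
Qed.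

Lemma measure_probability {dT : measure_display} {T : measurableType dT}
    {R : realType} (mu : {measure set T -> \bar R}) :
  mu setT = 1%E -> exists P : probability T R, forall Z, P Z = mu Z.
Proof.
case: mu => m cm muT.
pose M : {measure set T -> \bar R} := Measure.Pack cm.
pose f := Measure_isProbability.Build _ _ _ M muT.
pose P : probability T R := HB.pack m M f.
by exists P.
Qed.

(** The marginal computation for a glued coupling, in one cell: w is the row of
    masses sent from the cell, b the masses of the target cells, x the mass of
    the part of the cell that is measured. *)
Lemma sumr_reweight {R : realFieldType} {J : finType} (w b : J -> R) (x : R) :
  (forall j, b j = 0 -> w j = 0) -> 0 <= x <= \sum_j w j ->
  \sum_j w j / ((\sum_j w j) * b j) * (x * b j) = x.
Proof.
set a := \sum_j w j => bw /andP[x0 xa]; have [a0|a0] := eqVneq a 0.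
  have -> : x = 0 by apply/eqP; rewrite eq_le x0 -a0 xa.
  by rewrite big1// => j _; rewrite mul0r mulr0.
transitivity (\sum_j w j * (x / a)); last first.
  by rewrite -mulr_suml mulrC divfK.
apply: eq_bigr => j _; have [/bw ->|bj0] := eqVneq (b j) 0.
  by rewrite !mul0r.
by field; rewrite a0 bj0.
Qed.

(** A finite transport plan w between the masses of the cells becomes a coupling
    by spreading w i j over the product of the cells A i and B j as the
    normalised product measure
    w i j / (rho1 (A i) * rho2 (B j)) * (rho1 \x rho2).
    When a cell is null, so is the corresponding w i j, and the term vanishes
    as it should. The last conclusion confines the coupling to the products of
    cells between which w sends mass; that is how its support is located. *)
Lemma glue_coupling {d1 d2 : measure_display} {T1 : measurableType d1}
    {T2 : measurableType d2} {R : realType}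
    (rho1 : probability T1 R) (rho2 : probability T2 R) {I J : finType}
    (A : I -> set T1) (B : J -> set T2) (w : I -> J -> R) :
  (forall i, measurable (A i)) -> trivIset setT A -> \bigcup_i A i = setT ->
  (forall j, measurable (B j)) -> trivIset setT B -> \bigcup_j B j = setT ->
  (forall i j, 0 <= w i j) ->
  (forall i, (\sum_j w i j)%:E = rho1 (A i)) ->
  (forall j, (\sum_i w i j)%:E = rho2 (B j)) ->
  exists mu : probability (T1 * T2)%type R,
    [/\ forall S, measurable S -> mu (fst @^-1` S) = rho1 S,
        forall S, measurable S -> mu (snd @^-1` S) = rho2 S &
        forall Z, (forall i j, w i j != 0 -> Z `&` (A i `*` B j) = set0) ->
          mu Z = 0%E].
Proof.
move=> mA tA cA mB tB cB w0 wA wB.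
pose a i := \sum_j w i j; pose b j := \sum_i w i j.
have a0 i : 0 <= a i by exact: sumr_ge0.
have b0 j : 0 <= b j by exact: sumr_ge0.
have bw i j : b j = 0 -> w i j = 0.
  move=> /eqP; rewrite psumr_eq0// => /allP/(_ i).
  by rewrite mem_index_enum => /(_ isT)/eqP.
have aw i j : a i = 0 -> w i j = 0.
  move=> /eqP; rewrite psumr_eq0// => /allP/(_ j).
  by rewrite mem_index_enum => /(_ isT)/eqP.
have v0 (p : I * J) : 0 <= w p.1 p.2 / (a p.1 * b p.2).
  by rewrite divr_ge0// mulr_ge0.
have mAB (p : I * J) : measurable (A p.1 `*` B p.2) by exact: measurableX.
have [mu muE] := measure_finite_sum (fun p : I * J =>
  mscale (NngNum (v0 p)) (mrestr (rho1 \x rho2)%E (mAB p))).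
have rho1E S : measurable S -> rho1 S = (\sum_i rho1 (S `&` A i))%E.
  exact: measure_partition.
have rho2E S : measurable S -> rho2 S = (\sum_j rho2 (S `&` B j))%E.
  exact: measure_partition.
have muX S S' : measurable S -> measurable S' -> mu (S `*` S') =
    (\sum_i \sum_j (w i j / (a i * b j))%:E *
      (rho1 (S `&` A i) * rho2 (S' `&` B j)))%E.
  move=> mS mS'; rewrite muE pair_big/=; apply: eq_bigr => p _.
  rewrite /mscale/= /mrestr; congr (_ * _)%E.
  rewrite -setXI product_measure1E//; exact: measurableI.
have mu1 S : measurable S -> mu (fst @^-1` S) = rho1 S.
  move=> mS; have -> : fst @^-1` S = S `*` [set: T2].
    by apply/seteqP; split=> [x|x []].
  rewrite muX// rho1E//; apply: eq_bigr => i _.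
  have fin1 : rho1 (S `&` A i) \is a fin_num.
    by apply: fin_num_measure; exact: measurableI.
  have le1 : (0 <= rho1 (S `&` A i) <= (a i)%:E)%E.
    by rewrite measure_ge0/= wA le_measure ?inE//; exact: measurableI.
  move: fin1 le1; case: (rho1 (S `&` A i)) => // x _; rewrite !lee_fin => x0a.
  under eq_bigr => j _ do rewrite setTI -wB -!EFinM.
  by rewrite sumEFin sumr_reweight// => j /bw.
have mu2 S : measurable S -> mu (snd @^-1` S) = rho2 S.
  move=> mS; have -> : snd @^-1` S = [set: T1] `*` S.
    by apply/seteqP; split=> [x|x []].
  rewrite muX// rho2E// exchange_big/=; apply: eq_bigr => j _.
  have fin2 : rho2 (S `&` B j) \is a fin_num.
    by apply: fin_num_measure; exact: measurableI.
  have le2 : (0 <= rho2 (S `&` B j) <= (b j)%:E)%E.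
    by rewrite measure_ge0/= wB le_measure ?inE//; exact: measurableI.
  move: fin2 le2; case: (rho2 (S `&` B j)) => // x _; rewrite !lee_fin => x0b.
  under eq_bigr => i _ do
    rewrite setTI -wA -!EFinM [X in _ / X]mulrC [X in _ * X]mulrC.
  by rewrite sumEFin sumr_reweight// => i /aw.
have muT : mu setT = 1%E.
  by rewrite -(preimage_setT fst) mu1// probability_setT.
have [P PE] := measure_probability mu muT.
exists P; split=> [S mS|S mS|Z wZ]; rewrite PE ?mu1 ?mu2//.
rewrite muE big1// => p _.
change ((w p.1 p.2 / (a p.1 * b p.2))%:E *
  (rho1 \x rho2)%E (Z `&` (A p.1 `*` B p.2)) = 0)%E.
have [->|/wZ ->] := eqVneq (w p.1 p.2) 0; first by rewrite mul0r mul0e.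
by rewrite measure0 mule0.
Qed.

(** * Mass gaps and couplings *)

Lemma torus_far_open {R : realType} {d : nat} (s : R) :
  open [set z : torus R d * torus R d | s < mdist z.1 z.2].
Proof.
rewrite openE => -[x y] /= sxy.
pose e := (mdist x y - s) / 2.
have e0 : 0 < e by rewrite divr_gt0// subr_gt0.
exists (ball x e, ball y e); first by split; exact: nbhsx_ballx.
move=> [x' y'] [/=]; rewrite !ballEmdist/= => xx' yy'.
have := metric_triangle x x' y; have := metric_triangle x' y' y.
rewrite (metric_sym y' y) => t1 t2; rewrite /e in xx' yy'; lra.
Qed.

(** If all pairs of points in the support of a coupling were at distance less
    than r, then almost surely a first coordinate in S would force the second
    coordinate into the r-neighbourhood of S, which therefore would have at
    least the mass of S. *)
Lemma mass_gap_le_support_diameter {R : realType} {d : nat}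
    (rho1 rho2 : probability (torus R d) R)
    (mu : probability (torus R d * torus R d)%type R)
    (S : set (torus R d)) (r : R) :
  couplings rho1 rho2 mu -> measurable S ->
  (rho2 (thickening S r) < rho1 S)%E ->
  (r%:E <= ereal_sup [set (mdist z.1 z.2)%:E | z in measure_support mu])%E.
Proof.
move=> cmu mS gap; rewrite leNgt; apply/negP => supr.
have supp_lt z : measure_support mu z -> mdist z.1 z.2 < r.
  move=> zmu; rewrite -lte_fin; apply: le_lt_trans supr.
  by apply: ereal_sup_ubound; exists z.
have [N [mN N0 suppN]] := support_setC_negligible mu.
have mT := thickening_measurable S r.
have mF : measurable (fst @^-1` S : set (torus R d * torus R d)).
  by rewrite -[X in measurable X]setTI; exact: measurable_fst.
have mG : measurable (snd @^-1` thickening S r : set (torus R d * torus R d)).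
  by rewrite -[X in measurable X]setTI; exact: measurable_snd.
have := gap; rewrite -(cmu _ mS).1 -(cmu _ mT).2 /pushforward.
rewrite ltNge => /negP; apply.
have <- : mu (snd @^-1` thickening S r `|` N) = mu (snd @^-1` thickening S r).
  by rewrite measureU0.
apply: le_measure; rewrite ?inE//; first exact: measurableU.
move=> z Sz; have [zmu|] := pselect (measure_support mu z); last first.
  by move=> /suppN; right.
by left; rewrite thickening_bigcup; exists z.1 => //=; exact: supp_lt.
Qed.

(** Strassen's theorem for the torus, up to an error e that the infimum in the
    distance absorbs. Join two cells when they contain points at distance less
    than r. The hypothesis, applied to unions of cells, is Hall's condition for
    the masses of the cells, so that some plan only uses joined cells; the
    coupling glued from it stays within r plus the diameters of two cells. *)
Lemma exists_coupling_near {R : realType} {d : nat}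
    (rho1 rho2 : probability (torus R d) R) (r e : R) :
  0 < e ->
  (forall S, measurable S -> (rho1 S <= rho2 (thickening S r))%E) ->
  exists2 mu, couplings rho1 rho2 mu &
    forall z, measure_support mu z -> mdist z.1 z.2 <= r + e.
Proof.
move=> e0 dom.
have e20 : 0 < e / 2 by rewrite divr_gt0.
have [n [A [mA tA cA dA]]] := @torus_small_cells R d _ e20.
pose E : {set 'I_n * 'I_n} :=
  [set p | `[< exists x y, [/\ A p.1 x, A p.2 y & mdist x y < r] >]]%SET.
pose a i := fine (rho1 (A i)); pose b j := fine (rho2 (A j)).
have aE i : (a i)%:E = rho1 (A i) by rewrite fineK// fin_num_measure.
have bE j : (b j)%:E = rho2 (A j) by rewrite fineK// fin_num_measure.
have total (rho : probability (torus R d) R) : (\sum_i rho (A i))%E = 1%E.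
  rewrite -(probability_setT rho) (measure_partition rho A setT)//.
  by under [RHS]eq_bigr do rewrite setTI.
(* the r-neighbourhood of the union of the cells in B is covered by the cells
   joined to a cell of B *)
have [||||w [w0 wE wa wb]] := weighted_hall R _ _ E a b.
- by move=> i; rewrite fine_ge0.
- by move=> j; rewrite fine_ge0.
- apply: EFin_inj; rewrite -!sumEFin.
  under eq_bigr do rewrite aE; under [RHS]eq_bigr do rewrite bE.
  by rewrite !total.
- move=> B; rewrite -lee_fin -!sumEFin.
  under eq_bigr do rewrite aE; under [leRHS]eq_bigr do rewrite bE.
  rewrite -!measure_finite_union//.
  have mB (C : {set 'I_n}) : measurable (\bigcup_(i in [set` C]) A i).
    by apply: fin_bigcup_measurable => //; exact: finite_finset.
  apply: (le_trans (dom _ (mB B))); apply: le_measure; rewrite ?inE//.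
    exact: thickening_measurable.
  move=> y; rewrite thickening_bigcup => -[x [i /= iB Aix] xy].
  have [j _ Ajy] : (\bigcup_j A j) y by rewrite cA.
  exists j => //=; rewrite inE; apply/exists_inP; exists i => //.
  by rewrite inE; apply/asboolP; exists x, y.
have [||mu [mu1 mu2 mu0]] :=
    glue_coupling rho1 rho2 A A w mA tA cA mA tA cA w0.
- by move=> i; rewrite wa.
- by move=> j; rewrite wb.
exists mu; first by move=> S mS; split; [exact: mu1|exact: mu2].
move=> z zmu; rewrite leNgt; apply/negP => far.
have := zmu _ (torus_far_open (r + e)) far; rewrite mu0 ?ltxx// => i j wij.
apply/seteqP; split=> // -[x y] /= [xy [Aix Ajy]].
have : (i, j) \in E by apply: contraNT wij => /wE ->.
rewrite inE => /asboolP[x' [y' [/= Aix' Ajy' x'y']]].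
have := dA _ _ _ Aix Aix'; have := dA _ _ _ Ajy' Ajy.
have := metric_triangle x x' y; have := metric_triangle x' y' y.
by lra.
Qed.

Theorem theorem1p7 (R : realType) (d : nat)
    (rho1 rho2 : probability (torus R d) R) :
  d_infty rho1 rho2 =
  ereal_sup [set r%:E | r in [set r : R | 0 <= r /\
    exists S : set (torus R d),
      measurable S /\ (rho2 (thickening S r) < rho1 S)%E]].
Proof.
apply/eqP; rewrite eq_le; apply/andP; split; last first.
  apply: ge_ereal_sup => _ [r [r0 [S [mS gap]]] <-].
  apply: le_ereal_inf_tmp => _ [mu cmu <-].
  exact: mass_gap_le_support_diameter gap.
set G := [set r : R | _].
apply/lee_addgt0Pr => e e0.
have G0 : (0 <= ereal_sup [set r%:E | r in G])%E.
  apply: ereal_sup_ubound; exists 0 => //; split=> //; exists setT.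
  split=> //; rewrite probability_setT.
  have -> : thickening [set: torus R d] (0:R) = set0.
    rewrite thickening_bigcup; apply/seteqP; split=> // x [y _] /=.
    by rewrite ltNge mdist_ge0.
  by rewrite measure0.
have [->|supG] := eqVneq (ereal_sup [set r%:E | r in G]) +oo%E.
  by rewrite addye// leey.
have [s sE] : exists s, ereal_sup [set r%:E | r in G] = s%:E.
  by move: G0 supG; case: ereal_sup => // s; exists s.
rewrite sE in G0 *; rewrite lee_fin in G0.
have e20 : 0 < e / 2 by rewrite divr_gt0.
have [S mS|mu cmu near] :=
    @exists_coupling_near R d rho1 rho2 (s + e / 2) (e / 2) e20.
  rewrite leNgt; apply/negP => gap.
  have : ((s + e / 2)%:E <= s%:E)%E.
    rewrite -sE; apply: ereal_sup_ubound; exists (s + e / 2) => //.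
    by split; [rewrite addr_ge0// ltW|exists S].
  by rewrite lee_fin; lra.
apply: (@le_trans _ _
  (ereal_sup [set (mdist z.1 z.2)%:E | z in measure_support mu])).
  by apply: ereal_inf_lbound; exists mu.
apply: ge_ereal_sup => _ [z /near zse <-].
by rewrite -EFinD lee_fin; lra.
Qed.
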